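(* Let $m$ be a positive integer, $r$ a nonnegative integer, $\lambda\in\mathbb{R}$, and $n\ge0$. Then for every complex number $x$, $$D_{m,\lambda}^{(r)}(n,x)=e^{-\frac{x}{m}}\sum_{k=0}^{\infty}\Big(\frac{x}{m}\Big)^{k}\frac{(mk+r)_{n,\lambda}}{k!}.$$ In particular, $$D_{m,\lambda}^{(r)}(n,1)=e^{-\frac{1}{m}}\sum_{k=0}^{\infty}\frac{(mk+r)_{n,\lambda}}{m^{k}k!}.$$
   Context: $(x)_{0,\lambda}=1$, $(x)_{n,\lambda}=x(x-\lambda)\cdots(x-(n-1)\lambda)$, $(x)_n=(x)_{n,1}$. The degenerate $r$-Whitney numbers of the second kind are defined by the polynomial identities $(mx+r)_{n,\lambda}=\sum_{k=0}^n W_{m,\lambda}^{(r)}(n,k)m^k(x)_k$, and the degenerate $r$-Dowling polynomials by $D_{m,\lambda}^{(r)}(n,x)=\sum_{k=0}^n W_{m,\lambda}^{(r)}(n,k)x^k$, $n\ge0$. *)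

(* Defs.v *)
From Stdlib Require Import Reals Lra Lia Arith ClassicalEpsilon.
From Coquelicot Require Import Coquelicot.

Open Scope R_scope.

(* (x)_{n,lambda} = x (x - lambda) ... (x - (n-1) lambda). *)
Fixpoint degen_ff (lambda x : R) (n : nat) : R :=
  match n with
  | O => 1
  | S p => degen_ff lambda x p * (x - INR p * lambda)
  end.

(* The real polynomial identity is stated as equality at every real x.
   W n k is constrained only for k <= n. *)
Definition is_degen_whitney (m : nat) (lambda : R) (r : nat)
    (W : nat -> nat -> R) : Prop :=
  forall (n : nat) (x : R),
    degen_ff lambda (INR m * x + INR r) n =
    sum_n (fun k => W n k * INR m ^ k * degen_ff 1 x k) n.

(* Well defined for m > 0 by [degen_whitney_exists] and
   [degen_whitney_unique] below. *)
Definition degen_whitney (m : nat) (lambda : R) (r : nat) : nat -> nat -> R :=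
  epsilon (inhabits (fun _ _ => 0)) (is_degen_whitney m lambda r).

Definition degen_dowling (m : nat) (lambda : R) (r n : nat) (x : C) : C :=
  sum_n (fun k => (RtoC (degen_whitney m lambda r n k) * x ^ k)%C) n.

(* The complex exponential is absent from Coquelicot. *)
Definition Cexp (z : C) : C :=
  (exp (Re z) * cos (Im z), exp (Re z) * sin (Im z)).

Fixpoint whitney_rec (m : nat) (lambda : R) (r n k : nat) : R :=
  match n with
  | O => match k with O => 1 | S _ => 0 end
  | S p =>
      match k with O => 0 | S j => whitney_rec m lambda r p j end
      + (INR m * INR k + INR r - INR p * lambda) * whitney_rec m lambda r p k
  end.

Lemma whitney_rec_gt m lambda r n k :
  (n < k)%nat -> whitney_rec m lambda r n k = 0.
Proof.
revert k; induction n as [|n IH]; intros [|k] H; simpl; try lia; auto.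
rewrite (IH k), (IH (S k)) by lia; ring.
Qed.

Lemma degen_whitney_exists m lambda r :
  exists W, is_degen_whitney m lambda r W.
Proof.
exists (whitney_rec m lambda r); intros n x.
rewrite sum_n_Reals.
induction n as [|n IH]; [simpl; ring|].
change (degen_ff lambda (INR m * x + INR r) (S n)) with
  (degen_ff lambda (INR m * x + INR r) n * (INR m * x + INR r - INR n * lambda)).
rewrite IH.
set (w := whitney_rec m lambda r).
assert (H : forall N, sum_f_R0 (fun k => w n k * INR m ^ k * degen_ff 1 x k) N
   * (INR m * x + INR r - INR n * lambda)
  = sum_f_R0 (fun k => w (S n) k * INR m ^ k * degen_ff 1 x k) N
    + w n N * INR m ^ S N * degen_ff 1 x (S N)).
{ induction N as [|N IHN].
  - unfold w; simpl; ring.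
  - rewrite !tech5, Rmult_plus_distr_r, IHN.
    change (w (S n) (S N)) with
      (w n N + (INR m * INR (S N) + INR r - INR n * lambda) * w n (S N)).
    change (degen_ff 1 x (S (S N))) with
      (degen_ff 1 x (S N) * (x - INR (S N) * 1)).
    change (INR m ^ S (S N)) with (INR m * INR m ^ S N).
    ring. }
rewrite H, tech5; f_equal.
change (w (S n) (S n)) with
  (w n n + (INR m * INR (S n) + INR r - INR n * lambda) * w n (S n)).
unfold w; rewrite (whitney_rec_gt _ _ _ n (S n)) by lia; ring.
Qed.

Lemma degen_whitneyP m lambda r :
  is_degen_whitney m lambda r (degen_whitney m lambda r).
Proof. unfold degen_whitney; apply epsilon_spec, degen_whitney_exists. Qed.

Lemma degen_ff1_gt j k : (j < k)%nat -> degen_ff 1 (INR j) k = 0.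
Proof.
induction k as [|k IH]; intros H; [lia|simpl].
destruct (Nat.eq_dec j k) as [->|]; [ring|].
rewrite IH by lia; ring.
Qed.

Lemma degen_ff1_neq0 j k : (k <= j)%nat -> degen_ff 1 (INR j) k <> 0.
Proof.
induction k as [|k IH]; intros H; simpl; [lra|].
apply Rmult_integral_contrapositive; split; [apply IH; lia|].
assert (INR k < INR j) by (apply lt_INR; lia); lra.
Qed.

Lemma sum_f_R0_single (f : nat -> R) n j :
  (j <= n)%nat -> (forall k, (k <= n)%nat -> k <> j -> f k = 0) ->
  sum_f_R0 f n = f j.
Proof.
induction n as [|n IH]; intros Hj H; [now replace j with O by lia|].
rewrite tech5; destruct (Nat.eq_dec j (S n)) as [->|].
- rewrite sum_eq_R0; [ring|]; intros k Hk; apply H; lia.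
- rewrite IH, (H (S n)); try lia; [ring|]; intros k Hk; apply H; lia.
Qed.

Lemma degen_whitney_unique m lambda r W W' : (0 < m)%nat ->
  is_degen_whitney m lambda r W -> is_degen_whitney m lambda r W' ->
  forall n k, (k <= n)%nat -> W n k = W' n k.
Proof.
intros Hm HW HW' n j; induction j as [j IH] using lt_wf_ind; intros Hj.
pose proof (HW n (INR j)) as E; rewrite (HW' n (INR j)) in E.
rewrite !sum_n_Reals in E.
apply Rminus_diag_eq in E; rewrite <- minus_sum in E.
rewrite (sum_f_R0_single _ n j) in E; [|exact Hj|].
- assert (E' : (W' n j - W n j) * (INR m ^ j * degen_ff 1 (INR j) j) = 0)
    by (rewrite <- E; ring).
  apply Rmult_integral in E' as [E'|E']; [lra|exfalso; revert E'].
  apply Rmult_integral_contrapositive; split.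
  + apply pow_nonzero, not_0_INR; lia.
  + now apply degen_ff1_neq0.
- intros k Hk Hkj; destruct (lt_dec k j).
  + rewrite IH by lia; ring.
  + rewrite degen_ff1_gt by lia; ring.
Qed.

(* Main.v *)
(** By linearity in the expansion of [(m k + r)_{n,lambda}] over the falling
    factorials [(k)_j], the claim reduces to
    [sum_k z^k (k)_j / k! = z^j e^z] with [z = x / m], which follows by
    induction on [j] from [(k+1)_{j+1} = (k+1) (k)_j].  The case [j = 0], the
    exponential series at a complex point [z = a + i b], is obtained by solving
    the linear system [A' = a A - b B], [B' = b A + a B] satisfied by the real
    and imaginary parts of [t |-> sum_k (t z)^k / k!]. *)
Require Import Defs.
From Stdlib Require Import Reals Lra Lia Arith Factorial.
From Coquelicot Require Import Coquelicot.

Open Scope R_scope.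

(** * Complex series by components, and a radius of convergence criterion *)

Lemma RtoC_neq (x y : R) : x <> y -> RtoC x <> RtoC y.
Proof. intros H E; apply H, (RtoC_inj _ _ E). Qed.

Lemma sum_n_C (a : nat -> C) (n : nat) :
  sum_n a n = (sum_n (fun k => Re (a k)) n, sum_n (fun k => Im (a k)) n).
Proof.
induction n as [|n IH].
- rewrite !sum_O; now destruct (a O).
- now rewrite !sum_Sn, IH.
Qed.

(** Balls of the product uniform structure on [C] are products of balls, so the partial sums
    converge exactly when both components do. This carries real power series results over to [C]. *)
Lemma is_series_C (a : nat -> C) (l : C) :
  @is_series C_AbsRing C_NormedModule a l <->
  is_series (fun k => Re (a k)) (Re l) /\ is_series (fun k => Im (a k)) (Im l).
Proof.
unfold is_series; split.
- intros H; split; apply filterlim_locally; intros eps;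
    pose proof (proj1 (filterlim_locally (sum_n a) l) H eps) as He;
    revert He; apply filter_imp; intros n; rewrite sum_n_C; intros [H1 H2];
    assumption.
- intros [H1 H2]; apply filterlim_locally; intros eps.
  pose proof (proj1 (filterlim_locally _ _) H1 eps) as He1.
  pose proof (proj1 (filterlim_locally _ _) H2 eps) as He2.
  generalize (filter_and _ _ He1 He2); apply filter_imp.
  intros n [B1 B2]; rewrite sum_n_C; split; assumption.
Qed.

Lemma im_le_Cmod (z : C) : Rabs (Im z) <= Cmod z.
Proof.
eapply Rle_trans; [apply Rmax_r|apply (Rmax_Cmod z)].
Qed.

(** Comparison with the exponential series at [M * u] puts a point [u] beyond [Rabs t] in the disk
    of convergence. *)
Lemma Rbar_lt_CV_radius_exp (a : nat -> R) (M t : R) :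
  (forall k, Rabs (a k) <= M ^ k / INR (fact k)) ->
  Rbar_lt (Rabs t) (CV_radius a).
Proof.
intros Ha.
(* The least upper bound only gives a weak inequality; the slack of 1 makes it strict. *)
apply Rbar_lt_le_trans with (Rabs t + 1); [simpl; lra|].
apply (proj1 (Lub_Rbar_correct (CV_disk a))).
set (u := Rabs t + 1).
assert (Hu : 0 <= u) by (pose proof (Rabs_pos t); unfold u; lra).
apply (@ex_series_le R_AbsRing R_CompleteNormedModule _
  (fun k => / INR (fact k) * (M * u) ^ k)).
- intros k; change (Rabs (Rabs (a k * u ^ k)) <= / INR (fact k) * (M * u) ^ k).
  rewrite Rabs_Rabsolu, Rabs_mult, (Rabs_pos_eq (u ^ k)) by now apply pow_le.
  rewrite Rpow_mult_distr.
  replace (/ INR (fact k) * (M ^ k * u ^ k)) with (M ^ k / INR (fact k) * u ^ k)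
    by (unfold Rdiv; ring).
  apply Rmult_le_compat_r; [now apply pow_le|apply Ha].
- exists (exp (M * u)); apply is_pseries_R, is_exp_Reals.
Qed.

(** * The exponential series at a complex point *)

Section ComplexExponentialSeries.

Variable z : C.

Let A (k : nat) : R := Re (z ^ k)%C / INR (fact k).
Let B (k : nat) : R := Im (z ^ k)%C / INR (fact k).

Lemma CV_radius_Re_exp_coef (t : R) : Rbar_lt (Rabs t) (CV_radius A).
Proof.
apply Rbar_lt_CV_radius_exp with (Cmod z); intros k; unfold A, Rdiv.
pose proof (INR_fact_lt_0 k) as Hk; apply Rinv_0_lt_compat in Hk.
rewrite Rabs_mult, (Rabs_pos_eq (/ _)) by lra.
apply Rmult_le_compat_r; [lra|].
rewrite <- Cmod_pow; apply re_le_Cmod.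
Qed.

Lemma CV_radius_Im_exp_coef (t : R) : Rbar_lt (Rabs t) (CV_radius B).
Proof.
apply Rbar_lt_CV_radius_exp with (Cmod z); intros k; unfold B, Rdiv.
pose proof (INR_fact_lt_0 k) as Hk; apply Rinv_0_lt_compat in Hk.
rewrite Rabs_mult, (Rabs_pos_eq (/ _)) by lra.
apply Rmult_le_compat_r; [lra|].
rewrite <- Cmod_pow; apply im_le_Cmod.
Qed.

Lemma is_series_Re_exp_coef (t : R) : is_series (fun k => A k * t ^ k) (PSeries A t).
Proof. apply is_pseries_R, PSeries_correct, CV_radius_inside, CV_radius_Re_exp_coef. Qed.

Lemma is_series_Im_exp_coef (t : R) : is_series (fun k => B k * t ^ k) (PSeries B t).
Proof. apply is_pseries_R, PSeries_correct, CV_radius_inside, CV_radius_Im_exp_coef. Qed.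

(** Termwise differentiation: [z^(k+1) = z * z^k] and [(k+1)! = (k+1) * k!] give [(k+1) * A (k+1) =
    Re z * A k - Im z * B k]. *)
Lemma is_derive_Re_exp_coef (t : R) :
  is_derive (PSeries A) t (Re z * PSeries A t - Im z * PSeries B t).
Proof.
replace (_ - _) with (PSeries (PS_derive A) t);
  [apply is_derive_PSeries, CV_radius_Re_exp_coef|].
apply is_pseries_unique, is_pseries_R.
eapply is_series_ext;
  [|exact (is_series_minus _ _ _ _ (is_series_scal (Re z) _ _ (is_series_Re_exp_coef t))
             (is_series_scal (Im z) _ _ (is_series_Im_exp_coef t)))].
intros k; unfold A, B, PS_derive.
change ((Re z * (Re (z ^ k)%C / INR (fact k) * t ^ k) -
  Im z * (Im (z ^ k)%C / INR (fact k) * t ^ k))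
  = INR (S k) * (Re (z * z ^ k)%C / INR (fact (S k))) * t ^ k).
rewrite fact_simpl, mult_INR, re_mult.
field; split; [apply INR_fact_neq_0|now apply not_0_INR].
Qed.

Lemma is_derive_Im_exp_coef (t : R) :
  is_derive (PSeries B) t (Im z * PSeries A t + Re z * PSeries B t).
Proof.
replace (_ + _) with (PSeries (PS_derive B) t);
  [apply is_derive_PSeries, CV_radius_Im_exp_coef|].
apply is_pseries_unique, is_pseries_R.
eapply is_series_ext;
  [|exact (is_series_plus _ _ _ _ (is_series_scal (Im z) _ _ (is_series_Re_exp_coef t))
             (is_series_scal (Re z) _ _ (is_series_Im_exp_coef t)))].
intros k; unfold A, B, PS_derive.
change ((Im z * (Re (z ^ k)%C / INR (fact k) * t ^ k) +
  Re z * (Im (z ^ k)%C / INR (fact k) * t ^ k))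
  = INR (S k) * (Im (z * z ^ k)%C / INR (fact (S k))) * t ^ k).
rewrite fact_simpl, mult_INR, im_mult.
field; split; [apply INR_fact_neq_0|now apply not_0_INR].
Qed.

(* The two conserved quantities are the real and imaginary parts of
   [e^(-t z) (A t + i B t)]. *)
Lemma exp_series_Re_conserved :
  exp (- Re z) * (PSeries A 1 * cos (Im z) + PSeries B 1 * sin (Im z)) = 1.
Proof.
set (g t := exp (- Re z * t) *
  (PSeries A t * cos (Im z * t) + PSeries B t * sin (Im z * t))).
(* Substituting the linear system makes the derivative of [g] vanish, so [g] is constant. *)
assert (E : g 0 = g 1).
{ apply (eq_is_derive g 0 1); [|lra]; intros t _.
  unfold g; auto_derive.
  - repeat split; eexists; [apply is_derive_Re_exp_coef|apply is_derive_Im_exp_coef].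
  - rewrite (is_derive_unique (fun u : R => PSeries A u) _ _ (is_derive_Re_exp_coef t)).
    rewrite (is_derive_unique (fun u : R => PSeries B u) _ _ (is_derive_Im_exp_coef t)).
    change zero with 0; ring. }
(* At [t = 0] only the constant coefficients survive: [A 0 = 1] and [B 0 = 0]. *)
unfold g in E; rewrite !Rmult_0_r, !Rmult_1_r, exp_0, cos_0, sin_0, !PSeries_0 in E.
rewrite <- E; unfold A, B; simpl; field.
Qed.

Lemma exp_series_Im_conserved :
  exp (- Re z) * (PSeries B 1 * cos (Im z) - PSeries A 1 * sin (Im z)) = 0.
Proof.
set (g t := exp (- Re z * t) *
  (PSeries B t * cos (Im z * t) - PSeries A t * sin (Im z * t))).
assert (E : g 0 = g 1).
{ apply (eq_is_derive g 0 1); [|lra]; intros t _.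
  unfold g; auto_derive.
  - repeat split; eexists; [apply is_derive_Im_exp_coef|apply is_derive_Re_exp_coef].
  - rewrite (is_derive_unique (fun u : R => PSeries A u) _ _ (is_derive_Re_exp_coef t)).
    rewrite (is_derive_unique (fun u : R => PSeries B u) _ _ (is_derive_Im_exp_coef t)).
    change zero with 0; ring. }
unfold g in E; rewrite !Rmult_0_r, !Rmult_1_r, exp_0, cos_0, sin_0, !PSeries_0 in E.
rewrite <- E; unfold A, B; simpl; field.
Qed.

Lemma is_series_Cexp :
  @is_series C_AbsRing C_NormedModule
    (fun k => (z ^ k * / RtoC (INR (fact k)))%C) (Cexp z).
Proof.
assert (Hc : sin (Im z) * sin (Im z) + cos (Im z) * cos (Im z) = 1)
  by exact (sin2_cos2 (Im z)).
assert (He : exp (Re z) * exp (- Re z) = 1)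
  by (rewrite <- exp_plus, Rplus_opp_r; apply exp_0).
assert (EA : PSeries A 1 * cos (Im z) + PSeries B 1 * sin (Im z) = exp (Re z)).
{ apply (Rmult_eq_reg_l (exp (- Re z))); [|apply Rgt_not_eq, exp_pos].
  rewrite exp_series_Re_conserved, <- He; ring. }
assert (EB : PSeries B 1 * cos (Im z) - PSeries A 1 * sin (Im z) = 0).
{ apply (Rmult_eq_reg_l (exp (- Re z))); [|apply Rgt_not_eq, exp_pos].
  rewrite exp_series_Im_conserved; ring. }
apply is_series_C; split.
- replace (Re (Cexp z)) with (PSeries A 1).
  + eapply is_series_ext; [|exact (is_series_Re_exp_coef 1)]; intros k.
    rewrite <- RtoC_inv, re_scal_r, pow1, Rmult_1_r by apply INR_fact_neq_0; reflexivity.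
  + change (PSeries A 1 = exp (Re z) * cos (Im z)).
    (* [EA] and [EB] describe the pair of sums rotated by the angle [- Im z]. Rotating back isolates
       [PSeries A 1], and below [PSeries B 1]. *)
    transitivity ((PSeries A 1 * cos (Im z) + PSeries B 1 * sin (Im z)) * cos (Im z)
      - (PSeries B 1 * cos (Im z) - PSeries A 1 * sin (Im z)) * sin (Im z));
      [|rewrite EA, EB; ring].
    transitivity (PSeries A 1 *
      (sin (Im z) * sin (Im z) + cos (Im z) * cos (Im z))); [rewrite Hc|]; ring.
- replace (Im (Cexp z)) with (PSeries B 1).
  + eapply is_series_ext; [|exact (is_series_Im_exp_coef 1)]; intros k.
    rewrite <- RtoC_inv, im_scal_r, pow1, Rmult_1_r by apply INR_fact_neq_0; reflexivity.
  + change (PSeries B 1 = exp (Re z) * sin (Im z)).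
    transitivity ((PSeries A 1 * cos (Im z) + PSeries B 1 * sin (Im z)) * sin (Im z)
      + (PSeries B 1 * cos (Im z) - PSeries A 1 * sin (Im z)) * cos (Im z));
      [|rewrite EA, EB; ring].
    transitivity (PSeries B 1 *
      (sin (Im z) * sin (Im z) + cos (Im z) * cos (Im z))); [rewrite Hc|]; ring.
Qed.

End ComplexExponentialSeries.

Lemma Cexp_opp_mul (z : C) : (Cexp (- z) * Cexp z)%C = RtoC 1.
Proof.
assert (Hc : sin (Im z) * sin (Im z) + cos (Im z) * cos (Im z) = 1)
  by exact (sin2_cos2 (Im z)).
assert (He : exp (- Re z) * exp (Re z) = 1)
  by (rewrite <- exp_plus, Rplus_opp_l; apply exp_0).
unfold Cexp; rewrite re_opp, im_opp, cos_neg, sin_neg.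
apply injective_projections; simpl.
- transitivity (exp (- Re z) * exp (Re z) *
    (sin (Im z) * sin (Im z) + cos (Im z) * cos (Im z))); [ring|].
  rewrite He, Hc; ring.
- ring.
Qed.

Lemma Cexp_RtoC (t : R) : Cexp (RtoC t) = RtoC (exp t).
Proof.
unfold Cexp; simpl; rewrite cos_0, sin_0.
apply injective_projections; simpl; ring.
Qed.

(** * Factorial moments of the exponential series *)

Lemma degen_ff1_succ (x : R) (j : nat) :
  degen_ff 1 (x + 1) (S j) = (x + 1) * degen_ff 1 x j.
Proof.
induction j as [|j IH]; [simpl; ring|].
change (degen_ff 1 (x + 1) (S j) * (x + 1 - INR (S j) * 1)
  = (x + 1) * (degen_ff 1 x j * (x - INR j * 1))).
rewrite IH, S_INR; ring.
Qed.

(** For [j + 1], the term of index [k + 1] is [z] times the term of index [k] for [j]: the factor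
    [k + 1] of the falling factorial cancels the one in [(k+1)!]. *)
Lemma is_series_falling_Cexp (z : C) (j : nat) :
  @is_series C_AbsRing C_NormedModule
    (fun k => (z ^ k * (RtoC (degen_ff 1 (INR k) j) / RtoC (INR (fact k))))%C)
    (z ^ j * Cexp z)%C.
Proof.
induction j as [|j IH].
- replace (z ^ 0 * Cexp z)%C with (Cexp z) by (simpl; ring).
  eapply is_series_ext; [|apply is_series_Cexp].
  intros k; simpl; unfold Cdiv; ring.
(* Splits off the term of index 0, which is zero because [(0)_{j+1}] contains the factor 0. *)
- apply is_series_decr_1.
  replace (plus _ _) with (scal z (z ^ j * Cexp z)%C : C_NormedModule).
  + eapply is_series_ext; [|exact (is_series_scal z _ _ IH)].
    intros k; rewrite S_INR, degen_ff1_succ, <- S_INR, fact_simpl, mult_INR.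
    rewrite !RtoC_mult.
    change (z * (z ^ k * (RtoC (degen_ff 1 (INR k) j) / RtoC (INR (fact k)))) =
      z * z ^ k * (RtoC (INR (S k)) * RtoC (degen_ff 1 (INR k) j) /
        (RtoC (INR (S k)) * RtoC (INR (fact k)))))%C.
    field; split; apply RtoC_neq; [apply INR_fact_neq_0|now apply not_0_INR].
  + rewrite (degen_ff1_gt 0 (S j)) by lia.
    change (z * (z ^ j * Cexp z) =
      z * z ^ j * Cexp z + - (1 * (RtoC 0 / RtoC (INR (fact 0)))))%C.
    unfold Cdiv; ring.
Qed.

(** * Dowling polynomials as finite combinations of the moments *)

Lemma is_series_sum_n {K : AbsRing} {V : NormedModule K}
    (a : nat -> nat -> V) (l : nat -> V) (n : nat) :
  (forall j, is_series (a j) (l j)) ->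
  is_series (fun k => sum_n (fun j => a j k) n) (sum_n l n).
Proof.
intros H; induction n as [|n IH].
- rewrite sum_O; eapply is_series_ext; [|apply H]; intros k; now rewrite sum_O.
- rewrite sum_Sn; eapply is_series_ext; [|exact (is_series_plus _ _ _ _ IH (H _))].
  intros k; now rewrite sum_Sn.
Qed.

Lemma sum_n_RtoC (f : nat -> R) (n : nat) :
  RtoC (sum_n f n) = sum_n (fun k => RtoC (f k) : C_Ring) n.
Proof.
induction n as [|n IH]; [now rewrite !sum_O|].
rewrite !sum_Sn, <- IH; apply RtoC_plus.
Qed.

(** The exponential is kept on the side of the polynomial, so that the series is a combination of
    the moment series for [j <= n] with weights [w j * m^j]. Only finitely many series are added, so
    the interchange of sums needs no further convergence argument. *)
Lemma is_series_degen_dowling (m r n : nat) (lambda : R) (x : C) :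
  (0 < m)%nat ->
  @is_series C_AbsRing C_NormedModule
    (fun k => ((x / RtoC (INR m)) ^ k *
       (RtoC (degen_ff lambda (INR m * INR k + INR r) n) /
        RtoC (INR (fact k))))%C)
    (degen_dowling m lambda r n x * Cexp (x / RtoC (INR m)))%C.
Proof.
intros Hm; set (z := (x / RtoC (INR m))%C).
set (w := degen_whitney m lambda r n).
assert (Hm0 : RtoC (INR m) <> RtoC 0) by (apply RtoC_neq, not_0_INR; lia).
pose proof (is_series_sum_n
  (fun j k => scal (RtoC (w j * INR m ^ j) : C_AbsRing)
    (z ^ k * (RtoC (degen_ff 1 (INR k) j) / RtoC (INR (fact k))) : C_NormedModule)%C)
  (fun j => scal (RtoC (w j * INR m ^ j) : C_AbsRing)
     (z ^ j * Cexp z : C_NormedModule)%C) n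
  (fun j => is_series_scal _ _ _ (is_series_falling_Cexp z j))) as H.
replace (degen_dowling m lambda r n x * Cexp z)%C with
  (sum_n (fun j => scal (RtoC (w j * INR m ^ j) : C_AbsRing)
     (z ^ j * Cexp z : C_NormedModule)%C) n).
- eapply is_series_ext; [|exact H]; intros k.
  (* The defining polynomial identity is evaluated at the summation index [k]; the factor [z^k / k!]
     common to all [j] then comes out of the inner sum. *)
  rewrite (degen_whitneyP m lambda r n (INR k)), sum_n_RtoC.
  transitivity (sum_n (fun j => mult
    (RtoC (w j * INR m ^ j * degen_ff 1 (INR k) j) : C_Ring)
    (z ^ k * / RtoC (INR (fact k)))%C) n).
  + apply sum_n_ext; intros j; rewrite (RtoC_mult (w j * _)).
    unfold Cdiv, scal, mult; simpl; unfold mult; simpl; ring.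
  + rewrite (sum_n_mult_r (K := C_Ring)); unfold mult; simpl; unfold Cdiv; fold w; ring.
- unfold degen_dowling.
  rewrite <- (sum_n_mult_r (K := C_Ring) (Cexp z)); apply sum_n_ext; intros j.
  (* The weight [m^j] clears the denominator of [z^j], as [m * z = x]. *)
  replace (x ^ j)%C with (RtoC (INR m ^ j) * z ^ j)%C.
  + rewrite RtoC_mult; unfold scal, mult; simpl; unfold mult; simpl.
    fold w; ring.
  + rewrite RtoC_pow, <- Cpow_mult_l; f_equal; unfold z; field; exact Hm0.
Qed.

Theorem theorem14 (m r n : nat) (lambda : R) (Hm : (0 < m)%nat) :
  (forall x : C,
     exists S : C,
       @is_series C_AbsRing C_NormedModule
         (fun k : nat =>
            ((x / RtoC (INR m)) ^ k *
             (RtoC (degen_ff lambda (INR m * INR k + INR r) n) /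
              RtoC (INR (fact k))))%C) S /\
       degen_dowling m lambda r n x = (Cexp (- (x / RtoC (INR m))) * S)%C) /\
  (ex_series (fun k : nat =>
     degen_ff lambda (INR m * INR k + INR r) n / (INR m ^ k * INR (fact k))) /\
   degen_dowling m lambda r n (RtoC 1) =
   RtoC (exp (- (1 / INR m)) *
         Series (fun k : nat =>
           degen_ff lambda (INR m * INR k + INR r) n
           / (INR m ^ k * INR (fact k))))).
Proof.
split.
(* The sum is the polynomial times [Cexp (x / m)], and the prefactor [Cexp (- (x / m))] cancels that
   exponential. *)
- intros x; eexists; split; [now apply is_series_degen_dowling|].
  transitivity (degen_dowling m lambda r n x *
    (Cexp (- (x / RtoC (INR m))) * Cexp (x / RtoC (INR m))))%C; [|ring].
  rewrite Cexp_opp_mul; ring.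
- assert (Hm0 : INR m <> 0) by (apply not_0_INR; lia).
  set (D := degen_dowling m lambda r n (RtoC 1)).
  pose proof (is_series_degen_dowling m r n lambda (RtoC 1) Hm) as H.
  fold D in H; rewrite <- RtoC_div, Cexp_RtoC in H by exact Hm0.
  (* The real statement comes from the real part of the complex one at [x = 1]. It recovers [D]
     itself because the coefficients, and hence [D], are real. *)
  assert (HD : Im D = 0).
  { unfold D, degen_dowling; rewrite sum_n_C; cbn [Im snd].
    rewrite (sum_n_ext _ (fun _ => 0)), sum_n_const; [ring|].
    intros k; rewrite <- RtoC_pow, <- RtoC_mult; reflexivity. }
  apply is_series_C in H as [H _].
  (* The exponential at [1 / m] is already a real scalar here, so it factors out of the real part of
     the sum. *)
  rewrite re_scal_r in H.
  assert (H' : is_series (fun k => degen_ff lambda (INR m * INR k + INR r) n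
      / (INR m ^ k * INR (fact k))) (Re D * exp (1 / INR m))).
  { eapply is_series_ext; [|exact H]; intros k.
    change (@eq R (Re (RtoC (1 / INR m) ^ k *
      (RtoC (degen_ff lambda (INR m * INR k + INR r) n) / RtoC (INR (fact k))))%C)
      (degen_ff lambda (INR m * INR k + INR r) n / (INR m ^ k * INR (fact k)))).
    rewrite <- RtoC_pow, <- RtoC_div, <- RtoC_mult by apply INR_fact_neq_0.
    rewrite re_RtoC.
    replace (1 / INR m) with (/ INR m) by (field; exact Hm0); rewrite pow_inv.
    field; split; [apply INR_fact_neq_0|now apply pow_nonzero]. }
  split; [eexists; exact H'|].
  rewrite (is_series_unique _ _ H').
  replace (exp (- (1 / INR m)) * (Re D * exp (1 / INR m))) with (Re D).
  + apply injective_projections; [reflexivity|exact HD].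
  + transitivity (Re D * (exp (- (1 / INR m)) * exp (1 / INR m))); [|ring].
    rewrite <- exp_plus, Rplus_opp_l, exp_0; ring.
Qed.
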